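(* For all $n,m\ge2$, the $n$-leaf rose $R_n$ (the digraph with one vertex and $n$ edges) and the $m$-leaf rose $R_m$ are weak UDAF equivalent if and only if $n=m$.
   Context: $\mathbb N$ includes $0$; maps are written on the right of their arguments, and $p\circ q$ means first $p$, then $q$. A digraph $D=(V_D,E_D,s_D,t_D)$ consists of a vertex set, an edge set and functions $s_D,t_D:E_D\to V_D$ ($e$ is an edge from $(e)s_D$ to $(e)t_D$). A homomorphism $\phi:D_1\to D_2$ is a pair of maps $\phi_V$ on vertices, $\phi_E$ on edges compatible with $s$ and $t$; $\operatorname{Hom}(D_1,D_2)$ is the set of these. For $n\le m$ in $\mathbb Z\cup\{\pm\infty\}$, $\mathbb Z_{[n,m]}$ is the digraph with vertices the integers $i$ with $n\le i\le m$ and an edge $(i,i+1)$ from $i$ to $i+1$ whenever both are vertices. A bi-infinite walk in $D$ is an element of $\operatorname{Hom}(\mathbb Z_{[-\infty,\infty]},D)$. A UDAF digraph is a finite digraph $D$ such that for every $v\in V_D$ the number of $h\in\operatorname{Hom}(\mathbb Z_{[0,\infty]},D)$ with $(0)h_V=v$ is not $1$ and the number of $h\in\operatorname{Hom}(\mathbb Z_{[-\infty,0]},D)$ with $(0)h_V=v$ is not $1$. The core $D^\circ$ is the subdigraph of all edges and vertices occurring in bi-infinite walks in $D$. A walk $w\in\operatorname{Hom}(\mathbb Z_{[-\infty,0]},D)$ is rational if there are integers $n\le0$, $m\le-1$ with $(i)w_V=(i+m)w_V$ and $(i,i+1)w_E=(i+m,i+1+m)w_E$ for all $i<n$; otherwise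 irrational. Let $\sigma$ be the automorphism $i\mapsto i+1$ of $\mathbb Z_{[-\infty,\infty]}$. If $w$ is a bi-infinite walk in $D$ with $w\restriction_{\mathbb Z_{[-\infty,0]}}$ irrational and $n\in\mathbb Z$, let $R(w,n)=\{h\in\operatorname{Hom}(\mathbb Z_{[-\infty,\infty]},D): h\restriction_{\mathbb Z_{[-\infty,n]}}=w\restriction_{\mathbb Z_{[-\infty,n]}}\}$ and $R^u(w,n)=\{\langle\sigma\rangle\circ h:h\in R(w,n)\}$, where $\langle\sigma\rangle\circ h=\{\sigma^k\circ h:k\in\mathbb Z\}$. The sets $R^u(w,n)$ are the unindexed rays, and $(n)w_V$ is a central vertex of $R^u(w,n)$ (a ray may have several central vertices, coming from different representations). An unindexed beam is a finite union of unindexed rays. A multiset $M\in\mathbb N^{V_{D^\circ}}$ is a vertex count for an unindexed beam $B$ if $B$ is a disjoint union of unindexed rays $R_0,\dots,R_{k-1}$ having central vertices $v_0,\dots,v_{k-1}$ respectively with $(v)M=|\{i<k:v_i=v\}|$ for all $v\in V_{D^\circ}$. The relation $\sim_D$ is the equivalence relation on $\mathbb N^{V_{D^\circ}}$ generated by pairs $(M_1,M_2)$ which are both vertex counts of a common unindexed beam; it is a congruence on the additive monoid $\mathbb N^{V_{D^\circ}}$. The UDAF dimension monoid of $D$ is $\mathbb N^{V_{D^\circ}}/\sim_D$. UDAF digraphs $D_1,D_2$ are weak UDAF equivalent if their UDAF dimension monoids are isomorphic. *)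

(* Defs.v *)
From HB Require Import structures.
From mathcomp Require Import all_boot all_order all_algebra generic_quotient.
From mathcomp Require Import boolp classical_sets.
From Stdlib Require Import Relation_Operators.

Set Implicit Arguments.
Unset Strict Implicit.
Unset Printing Implicit Defensive.

Import Order.TTheory GRing.Theory Num.Theory.

Local Open Scope classical_set_scope.
Local Open Scope ring_scope.
Local Open Scope quotient_scope.

Record digraph := Digraph {
  vertex : Type;
  edge : Type;
  src : edge -> vertex;
  tgt : edge -> vertex }.

Record dhom (D1 D2 : digraph) := Hom {
  homV : vertex D1 -> vertex D2;
  homE : edge D1 -> edge D2;
  hom_src : forall e, src (homE e) = homV (src e);
  hom_tgt : forall e, tgt (homE e) = homV (tgt e) }.

(* Composition in diagrammatic order: first [p], then [q]. *)
Definition hom_comp (D1 D2 D3 : digraph) (p : dhom D1 D2) (q : dhom D2 D3) :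
  dhom D1 D3.
Proof.
exists (homV q \o homV p) (homE q \o homE p) => e /=.
  by rewrite !hom_src.
by rewrite !hom_tgt.
Defined.

(* The digraph of the integers lying in an interval [I], which may be unbounded
   on either side.  The edge [(i, i + 1)] is represented by its source [i]. *)
Definition Zdigraph (I : interval int) : digraph :=
  @Digraph {i : int | i \in I} {i : int | (i \in I) && (i + 1 \in I)}
    (fun e => exist _ (val e) (proj1 (andP (valP e))))
    (fun e => exist _ (val e + 1) (proj2 (andP (valP e)))).

Definition Zfull : digraph := Zdigraph `]-oo, +oo[.

Definition Zvertex (i : int) : vertex Zfull := exist _ i isT.
Definition Zedge (i : int) : edge Zfull := exist _ i isT.

Definition walk (D : digraph) := dhom Zfull D.

Definition Zincl (I : interval int) : dhom (Zdigraph I) Zfull.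
Proof.
exists (fun i => Zvertex (val i)) (fun e => Zedge (val e)) => e; exact: val_inj.
Defined.

Definition walk_restrict (D : digraph) (I : interval int) (w : walk D) :
  dhom (Zdigraph I) D := hom_comp (Zincl I) w.

(* [Zshift k] is the [k]-th power, [k] an integer, of the automorphism
   [i |-> i + 1] of [Zfull]. *)
Definition Zshift (k : int) : dhom Zfull Zfull.
Proof.
exists (fun i => Zvertex (val i + k)) (fun e => Zedge (val e + k)) => e;
  apply: val_inj => //=.
by rewrite addrAC.
Defined.

Record finDigraph := FinDigraph {
  fvertex : finType;
  fedge : finType;
  fsrc : fedge -> fvertex;
  ftgt : fedge -> fvertex }.

Definition digraph_of_fin (D : finDigraph) : digraph :=
  Digraph (@fsrc D) (@ftgt D).
Coercion digraph_of_fin : finDigraph >-> digraph.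

Definition is_udaf (D : finDigraph) : Prop :=
  forall v : fvertex D,
    ~ (exists! h : dhom (Zdigraph `[0, +oo[) D, homV h (exist _ 0 isT) = v) /\
    ~ (exists! h : dhom (Zdigraph `]-oo, 0]) D, homV h (exist _ 0 isT) = v).

Section Core.
Variable D : finDigraph.

Definition core_vertex : pred (fvertex D) :=
  fun v => `[< exists (w : walk D) (i : int), homV w (Zvertex i) = v >].

Definition core_edge : pred (fedge D) :=
  fun e => `[< exists (w : walk D) (i : int), homE w (Zedge i) = e >].

Lemma core_src e : core_edge e -> core_vertex (fsrc e).
Proof.
move=> /asboolP[w [i <-]]; apply/asboolP; exists w, i.
rewrite -[fsrc _]/(src (homE w (Zedge i))) hom_src; congr homV; exact: val_inj.
Qed.

Lemma core_tgt e : core_edge e -> core_vertex (ftgt e).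
Proof.
move=> /asboolP[w [i <-]]; apply/asboolP; exists w, (i + 1).
rewrite -[ftgt _]/(tgt (homE w (Zedge i))) hom_tgt; congr homV; exact: val_inj.
Qed.

Definition core : finDigraph :=
  @FinDigraph {v : fvertex D | core_vertex v} {e : fedge D | core_edge e}
    (fun e => exist _ (fsrc (val e)) (core_src (valP e)))
    (fun e => exist _ (ftgt (val e)) (core_tgt (valP e))).

End Core.

Definition rational (D : digraph) (w : dhom (Zdigraph `]-oo, 0]) D) : Prop :=
  exists n m : int, [/\ n <= 0, m <= -1,
    forall i j : vertex (Zdigraph `]-oo, 0]),
      val i < n -> val j = val i + m -> homV w i = homV w j
  & forall e f : edge (Zdigraph `]-oo, 0]),
      val e < n -> val f = val e + m -> homE w e = homE w f].

Definition irrational (D : digraph) (w : dhom (Zdigraph `]-oo, 0]) D) : Prop :=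
  ~ rational w.

Section Beams.
Variable D : finDigraph.

Definition unindexed (h : walk D) : set (walk D) :=
  [set hom_comp (Zshift k) h | k in [set: int]].

Definition ray (w : walk D) (n : int) : set (walk D) :=
  [set h | walk_restrict `]-oo, n] h = walk_restrict `]-oo, n] w].

Definition unindexed_ray (w : walk D) (n : int) : set (set (walk D)) :=
  [set unindexed h | h in ray w n].

Definition is_unindexed_ray (R : set (set (walk D))) : Prop :=
  exists (w : walk D) (n : int),
    irrational (walk_restrict `]-oo, 0] w) /\ R = unindexed_ray w n.

Definition central_vertex (R : set (set (walk D))) (v : fvertex D) : Prop :=
  exists (w : walk D) (n : int),
    [/\ irrational (walk_restrict `]-oo, 0] w), R = unindexed_ray w n
      & v = homV w (Zvertex n)].

Definition is_unindexed_beam (B : set (set (walk D))) : Prop :=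
  exists (k : nat) (R : 'I_k -> set (set (walk D))),
    (forall i, is_unindexed_ray (R i)) /\ B = \bigcup_(i in [set: 'I_k]) R i.

Definition multiset : Type := {ffun fvertex (core D) -> nat}.

Definition vertex_count (M : multiset) (B : set (set (walk D))) : Prop :=
  exists (k : nat) (R : 'I_k -> set (set (walk D)))
         (v : 'I_k -> fvertex (core D)),
    [/\ forall i, is_unindexed_ray (R i) /\ central_vertex (R i) (val (v i)),
        trivIset [set: 'I_k] R,
        B = \bigcup_(i in [set: 'I_k]) R i
      & forall x, M x = #|[set i | v i == x]%SET| ].

Definition common_beam (M1 M2 : multiset) : Prop :=
  exists B, [/\ is_unindexed_beam B, vertex_count M1 B & vertex_count M2 B].

Definition udaf_rel : multiset -> multiset -> Prop :=
  clos_refl_sym_trans multiset common_beam.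

Definition udaf_relb : rel {ffun fvertex (core D) -> nat} :=
  fun M1 M2 => `[< udaf_rel M1 M2 >].

Lemma udaf_relb_equiv : equiv_class_of udaf_relb.
Proof.
split=> [M|M1 M2|M1 M2 M3].
- by apply/asboolP/rst_refl.
- by apply/asboolP/asboolP; apply: rst_sym.
- by move=> /asboolP h1 /asboolP h2; apply/asboolP; apply: rst_trans h1 h2.
Qed.

Canonical udaf_equiv := EquivRelPack udaf_relb_equiv.

Definition dim_monoid := {eq_quot udaf_equiv}.

(* [lift_op2] adds canonical representatives.  For UDAF digraphs [udaf_rel] is a
   congruence, so this is the quotient addition. *)
Definition dim_zero : dim_monoid := \pi_dim_monoid 0.
Definition dim_add : dim_monoid -> dim_monoid -> dim_monoid :=
  lift_op2 dim_monoid +%R.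

End Beams.

Definition weak_udaf_equivalent (D1 D2 : finDigraph) : Prop :=
  [/\ is_udaf D1, is_udaf D2
    & exists f : dim_monoid D1 -> dim_monoid D2,
        [/\ bijective f, f (dim_zero D1) = dim_zero D2
          & {morph f : x y / dim_add x y >-> dim_add x y}]].

Definition rose (n : nat) : finDigraph :=
  @FinDigraph unit 'I_n (fun=> tt) (fun=> tt).

(* Main.v *)
Require Import Defs.
From mathcomp Require Import all_boot.
From mathcomp Require Import all_order all_algebra generic_quotient zify.
From mathcomp Require Import boolp classical_sets.
From Stdlib Require Import Relation_Operators.

Set Implicit Arguments.
Unset Strict Implicit.
Unset Printing Implicit Defensive.

Import Order.TTheory GRing.Theory Num.Theory.

Local Open Scope classical_set_scope.
Local Open Scope ring_scope.

(** In the rose with [n] leaves, two nonzero vertex counts [k] and [l] are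
    related exactly when [k = l] modulo [n - 1], and [0] is related only to
    itself.  Hence the dimension monoid has [n] elements, and an isomorphism
    already forces the numbers of leaves to agree because it is a bijection.

    One direction is [disjoint_rays_split]: choosing the label of the next edge
    cuts a ray into [n] rays, and irrationality keeps these disjoint, since a
    walk that agrees with a nontrivial shift of itself far to the left is
    eventually periodic there.  So [k] is related to [k + (n - 1)] as soon as
    [k] is positive and [k] disjoint rays exist.

    The other direction is a count modulo [n - 1].  Pick one reference sequence
    in each class of sequences having the same left tail up to shift
    ([cotail_section]).  An irrational walk has exactly one shift that agrees
    with its reference far to the left, so the unindexed walks of a beam
    correspond to honest sequences, and each ray becomes a cone: all normalized
    sequences with prescribed labels below some position ([cone_normal]).  For
    large [L] the sequences of the beam that are constantly [0] from [L] on are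
    finite in number, and a cone prescribed below [m] contains [n ^ (L - m)] of
    them, which is [1] modulo [n - 1].  Their total is intrinsic to the beam, is
    congruent to the number of rays, and vanishes only if there are no rays
    ([disjoint_rays_class]). *)

(** * Bi-infinite sequences up to shift *)

Section Sequences.
Variable T : Type.
Implicit Types (f g h : int -> T) (m k p : int).

Definition agree m f g := forall i, i < m -> f i = g i.

Definition rotate k f : int -> T := fun i => f (i + k).

(** Both signs of [p] are allowed, which makes the notion usable without case
    analysis on the direction of a shift; [irrational_label] reconciles it with
    irrationality of a left-infinite walk. *)
Definition aperiodic f := forall m p, agree m f (rotate p f) -> p = 0.

Definition cotail f g := exists m k, agree m f (rotate k g).

Lemma rotateK k f : rotate (- k) (rotate k f) = f.
Proof. by apply/funext => i; rewrite /rotate subrK. Qed.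

Lemma agree_rotate m k f g :
  agree m f g -> agree (m - k) (rotate k f) (rotate k g).
Proof. by move=> fg i im; apply: fg; lia. Qed.

Lemma agreeW m k f g : k <= m -> agree m f g -> agree k f g.
Proof. by move=> km fg i ik; apply: fg; lia. Qed.

Lemma agree_sym m f g : agree m f g -> agree m g f.
Proof. by move=> fg i im; rewrite fg. Qed.

Lemma agree_trans m f g h : agree m f g -> agree m g h -> agree m f h.
Proof. by move=> fg gh i im; rewrite fg ?gh. Qed.

Lemma aperiodic_agree m f g : agree m f g -> aperiodic f -> aperiodic g.
Proof.
move=> fg af k p gp.
pose N := Num.min (Num.min m k) (m - p).
apply: (af N) => i iN; rewrite fg; last lia.
by rewrite gp; last lia; rewrite /rotate fg //; lia.
Qed.

Lemma aperiodic_rotate k f : aperiodic f -> aperiodic (rotate k f).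
Proof.
move=> af m p fp; apply: (af (m + k)) => i im.
have := fp (i - k); rewrite /rotate subrK => ->; last lia.
by congr f; lia.
Qed.

Lemma cotail_sym f g : cotail f g -> cotail g f.
Proof.
move=> [m [k fg]]; exists (m + k), (- k) => i im.
by rewrite /rotate fg; [rewrite /rotate subrK | lia].
Qed.

Lemma cotail_trans f g h : cotail f g -> cotail g h -> cotail f h.
Proof.
move=> [m [k fg]] [m' [k' gh]]; exists (Num.min m (m' - k)), (k + k') => i im.
by rewrite fg /rotate ?gh /rotate ?addrA //; lia.
Qed.

Lemma cotail_agree m f g : agree m f g -> cotail f g.
Proof. by move=> fg; exists m, 0 => i im; rewrite /rotate addr0 fg. Qed.

Lemma cotail_rotate k f : cotail (rotate k f) f.
Proof. by exists 0, k. Qed.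

(** The choice of a representative must depend on the class only, so that
    equivalent sequences get the same one; this is where propositional
    extensionality and choice enter. *)
Lemma cotail_section : exists rep : (int -> T) -> int -> T,
  (forall f, cotail f (rep f)) /\ (forall f g, cotail f g -> rep f = rep g).
Proof.
have ex f : exists g, cotail f g by exists f; apply: (@cotail_agree 0).
exists (fun f => projT1 (cid (ex f))); split=> [f|f g fg]; first by case: cid.
have e : cotail f = cotail g.
  apply/funext => h; apply/propext; split; apply: cotail_trans => //.
  exact: cotail_sym.
move: (ex f) (ex g); rewrite e => p q; congr (projT1 (cid _)).
exact: Prop_irrelevance.
Qed.

(** Among the shifts of a sequence, those aligned with its reference [rep]. *)
Definition normal (rep : (int -> T) -> int -> T) f :=
  exists m, agree m f (rep f).

Section Normal.
Variable rep : (int -> T) -> int -> T.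
Hypotheses (repP : forall f, cotail f (rep f))
           (rep_eq : forall f g, cotail f g -> rep f = rep g).

Lemma normalizable f : exists k, normal rep (rotate k f).
Proof.
have [m [k fk]] := repP f; exists (- k), (m + k) => i im.
rewrite (rep_eq (cotail_rotate (- k) f)) /rotate fk ?/rotate ?subrK //; lia.
Qed.

Lemma normal_agree m f g : agree m f g -> normal rep f -> normal rep g.
Proof.
move=> fg [k fr]; exists (Num.min m k); rewrite -(rep_eq (cotail_agree fg)).
move=> i ik; rewrite -fg ?fr //; lia.
Qed.

(** Two normal shifts of a sequence agree far to the left with the same
    reference, hence with each other; aperiodicity leaves only the trivial
    shift. *)
Lemma normal_rotate_eq0 k f :
  aperiodic f -> normal rep f -> normal rep (rotate k f) -> k = 0.
Proof.
move=> af [m fm] [m']; rewrite (rep_eq (cotail_rotate k f)) => fk.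
by apply: (af (Num.min m m')) => i im; rewrite fm ?fk //; lia.
Qed.

End Normal.
End Sequences.

Section Pow2.
Variable n : nat.

Definition pow2_marks (i : int) : 'I_n.+2 :=
  if `[< exists j : nat, i = - (2 ^ j)%N%:Z >] then ord_max else ord0.

(** A period [p] would send a mark [- 2 ^ j] with [2 ^ j > p] to another mark,
    but [2 ^ j < 2 ^ j + p < 2 ^ j.+1]. *)
Lemma pow2_marks_aperiodic : aperiodic pow2_marks.
Proof.
have marks1 i : pow2_marks i = ord_max <-> exists j : nat, i = - (2 ^ j)%N%:Z.
  rewrite /pow2_marks; case: asboolP => // nj; split=> // /(congr1 val) //.
have main m (p : int) :
    0 < p -> agree m pow2_marks (rotate (- p) pow2_marks) -> False.
  move=> p0 mp.
  have [j mj pj] : exists2 j : nat, (`|m| < 2 ^ j)%N & (`|p| < 2 ^ j)%N.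
    exists (`|m| + `|p|)%N;
      by have := ltn_expl (`|m| + `|p|) (isT : 1 < 2)%N; lia.
  have : pow2_marks (- (2 ^ j)%N%:Z) = ord_max by apply/marks1; exists j.
  rewrite mp; last lia.
  rewrite /rotate => /marks1[l] e.
  have jl1 : (2 ^ j < 2 ^ l)%N by lia.
  have jl2 : (2 ^ l < 2 ^ j.+1)%N by rewrite expnS; lia.
  by move: jl1 jl2; rewrite !ltn_exp2l // ltnS; lia.
move=> m p mp; case: (ltrgtP p 0) => // p0; exfalso.
  by apply: (main m (- p)); rewrite ?opprK //; lia.
apply: (main (m + p) p) => // i im.
by rewrite [RHS]mp /rotate ?subrK //; lia.
Qed.

End Pow2.

(** * Walks and rays in a rose *)

Section Walks.
Variable n : nat.
Local Notation D := (rose n).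
Implicit Types (h w : walk D) (f g : int -> 'I_n) (m k : int).

Definition label h : int -> 'I_n := fun i => homE h (Zedge i).

Definition labelled (G : digraph) (f : edge G -> 'I_n) : dhom G D :=
  @Defs.Hom G D (fun=> tt) f (fun=> erefl) (fun=> erefl).

(** A rose has a single vertex, so a homomorphism into it is a free labelling of
    the edges of its source. *)
Lemma rose_hom_eq (G : digraph) (g h : dhom G D) : homE g =1 homE h -> g = h.
Proof.
case: g h => [gV gE gs gt] [hV hE hs ht] /= /funext e.
have eV : gV = hV by apply/funext => x; case: (gV x); case: (hV x).
move: gs gt hs ht; rewrite e eV => gs gt hs ht.
by congr Defs.Hom; apply: Prop_irrelevance.
Qed.

Definition of_label f : walk D := labelled (G := Zfull) (fun e => f (val e)).

Lemma of_labelK f : label (of_label f) = f.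
Proof. by []. Qed.

Lemma labelK h : of_label (label h) = h.
Proof. by apply: rose_hom_eq => e /=; congr (homE h _); apply: val_inj. Qed.

Lemma label_inj : injective label.
Proof. exact: can_inj labelK. Qed.

Lemma label_shift k h : label (hom_comp (Zshift k) h) = rotate k (label h).
Proof. by []. Qed.

Lemma walk_restrictP m h w :
  walk_restrict `]-oo, m] h = walk_restrict `]-oo, m] w <->
  agree m (label h) (label w).
Proof.
split=> [e i im|hw].
  have ip : (i \in `]-oo, m]) && (i + 1 \in `]-oo, m]).
    by rewrite !in_itv /=; lia.
  exact: (congr1 (fun u : dhom (Zdigraph _) D => homE u (exist _ i ip)) e).
apply: rose_hom_eq => -[i /= ip]; apply: hw.
by case/andP: ip; rewrite !in_itv /=; lia.
Qed.

Lemma irrational_label w :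
  irrational (walk_restrict `]-oo, 0] w) <-> aperiodic (label w).
Proof.
split=> [irr|ap [a [p [a0 p1 _ wE]]]].
  have neg m p : p < 0 -> ~ agree m (label w) (rotate p (label w)).
    move=> p0 wp; apply: irr; exists (Num.min 0 m), p; split; try lia.
      by move=> i j _ _; case: (homV _ i); case: (homV _ j).
    by move=> [i ip] [j jp] /= im e; rewrite e; apply: wp; lia.
  move=> m p wp; case: (ltrgtP p 0) => // p0; exfalso.
    exact: (neg m p).
  apply: (neg (m + p) (- p)) => [|i im]; first lia.
  by rewrite [RHS]wp /rotate ?subrK //; lia.
suff : p = 0 by lia.
apply: (ap a) => i ia.
have ip : (i \in `]-oo, 0]) && (i + 1 \in `]-oo, 0]) by rewrite !in_itv /=; lia.
have jp : (i + p \in `]-oo, 0]) && (i + p + 1 \in `]-oo, 0]).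
  by rewrite !in_itv /=; lia.
exact: (wE (exist _ i ip) (exist _ (i + p) jp)).
Qed.

Definition shift_class f : set (walk D) := unindexed (of_label f).

Lemma shift_class_rotate k f : shift_class (rotate k f) = shift_class f.
Proof.
apply/seteqP; split=> _ [j _ <-] /=.
  exists (j + k) => //; apply: label_inj; rewrite !label_shift !of_labelK.
  by rewrite /rotate; apply/funext => i; rewrite addrA.
exists (j - k) => //; apply: label_inj; rewrite !label_shift !of_labelK.
by rewrite /rotate; apply/funext => i; congr f; lia.
Qed.

Lemma shift_class_eqP f g :
  shift_class f = shift_class g <-> exists k, f = rotate k g.
Proof.
split=> [e|[k ->]]; last exact: shift_class_rotate.
have : shift_class f (of_label f).
  exists 0 => //; apply: label_inj; rewrite label_shift.
  by apply/funext => i; rewrite /rotate addr0.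
rewrite e => -[k _ fk]; exists k.
by rewrite -[LHS]of_labelK -fk label_shift.
Qed.

Definition cone f m : set (set (walk D)) :=
  [set shift_class g | g in agree m^~ f].

Lemma unindexed_ray_cone w m : unindexed_ray w m = cone (label w) m.
Proof.
apply/seteqP; split=> [_ [h /walk_restrictP hw <-]|_ [g gw <-]] /=.
  by exists (label h) => //; rewrite /shift_class labelK.
by exists (of_label g) => //; apply/walk_restrictP; rewrite of_labelK.
Qed.

Lemma is_unindexed_rayP R :
  is_unindexed_ray R <-> exists f m, aperiodic f /\ R = cone f m.
Proof.
split=> [[w [m [/irrational_label aw ->]]]|[f [m [af ->]]]].
  by exists (label w), m; rewrite -unindexed_ray_cone.
by exists (of_label f), m; rewrite irrational_label unindexed_ray_cone.
Qed.

Lemma cone_rotate k m f : cone (rotate k f) (m - k) = cone f m.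
Proof.
apply/seteqP; split=> _ [h hf <-].
  exists (rotate (- k) h); last exact: shift_class_rotate.
  by move: (agree_rotate (k := - k) hf); rewrite opprK subrK rotateK.
by exists (rotate k h); [apply: agree_rotate | exact: shift_class_rotate].
Qed.

(** Irrationality is what makes an unindexed ray look like an indexed one: inside
    a ray, passing to shift classes loses nothing. *)
Lemma shift_class_inj m f g :
  agree m f g -> aperiodic f -> shift_class f = shift_class g -> f = g.
Proof.
move=> fg af /shift_class_eqP[k e].
suff k0 : k = 0 by rewrite e k0; apply/funext => i; rewrite /rotate addr0.
by apply: (af (m - `|k|)) => i im; rewrite {1}e /rotate fg //; lia.
Qed.

(** Once restricted to normal sequences, membership in an unindexed ray is a
    condition on labels alone, with no shift left to quantify over. *)
Lemma cone_normal rep (R : set (set (walk D))) :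
  (forall f, cotail f (rep f)) -> (forall f g, cotail f g -> rep f = rep g) ->
  is_unindexed_ray R ->
  exists g m, normal rep g /\
    forall f, normal rep f -> (R (shift_class f) <-> agree m f g).
Proof.
move=> repP rep_eq /is_unindexed_rayP[f [m [af ->]]].
have [k nk] := normalizable repP rep_eq f.
exists (rotate k f), (m - k); split=> // h nh; rewrite -(cone_rotate k).
split=> [[g gw /shift_class_eqP[j e]]|hw]; last by exists h.
have ag : aperiodic g.
  by apply: aperiodic_agree (agree_sym gw) (aperiodic_rotate af).
have ng := normal_agree rep_eq (agree_sym gw) nk.
have ah : aperiodic h.
  by have := aperiodic_rotate (k := - j) ag; rewrite e rotateK.
have j0 : j = 0 by apply: (normal_rotate_eq0 rep_eq ah nh); rewrite -e.
suff <- : g = h by [].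
by rewrite e j0; apply/funext => i; rewrite /rotate addr0.
Qed.

End Walks.

(** * Counting the rays in a beam *)

Definition disjoint_rays (D : finDigraph) (I : Type)
    (R : I -> set (set (walk D))) : Prop :=
  (forall i, is_unindexed_ray (R i)) /\ trivIset [set: I] R.

Definition beam_of (D : finDigraph) (I : Type)
  (R : I -> set (set (walk D))) : set (set (walk D)) := \bigcup_i R i.

(** Compares two enumerations of a set of sequences that carries no finite type
    structure of its own. *)
Lemma leq_card_codom (I J : finType) (X : Type) (F : I -> X) (G : J -> X) :
  injective F -> (forall x, exists y, G y = F x) -> (#|I| <= #|J|)%N.
Proof.
move=> injF FG; pose phi x := projT1 (cid (FG x)).
have phiP x : G (phi x) = F x by rewrite /phi; case: cid.
apply: (@leq_card _ _ phi) => x y e.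
by apply: injF; rewrite -!phiP e.
Qed.

Section Counting.
Variable n : nat.
Local Notation D := (rose n.+1).

(** The sequence [f] below [m], then the block [u] of [d] labels, then zeros;
    [insub] fails exactly beyond the block. *)
Definition graft (f : int -> 'I_n.+1) (m : int) (d : nat)
    (u : {ffun 'I_d -> 'I_n.+1}) : int -> 'I_n.+1 := fun i =>
  if i < m then f i else
  if insub (absz (i - m)%R) is Some j then u j else ord0.

Lemma graft_inj f m d : injective (@graft f m d).
Proof.
move=> u v e; apply/ffunP => j.
have := congr1 (fun z : int -> _ => z (m + (val j)%:Z)) e; rewrite /graft.
have -> : (m + (val j)%:Z < m) = false by lia.
have -> : absz (m + (val j)%:Z - m)%R = val j by rewrite addrAC subrr add0r.
by rewrite valK.
Qed.

Lemma graftP f m d h :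
  (exists u, @graft f m d u = h) <->
  agree m h f /\ forall i, m + d%:Z <= i -> h i = ord0.
Proof.
split=> [[u <-]|[hf h0]].
  split=> i im; rewrite /graft; first by rewrite im.
  have -> : (i < m) = false by lia.
  by rewrite insubN //; lia.
exists [ffun j : 'I_d => h (m + (val j)%:Z)]; apply/funext => i; rewrite /graft.
case: ifP => im; first by rewrite hf.
case: insubP => [j _ ji|di]; last by rewrite h0 //; lia.
by rewrite ffunE ji; congr h; lia.
Qed.

Section Family.
Variable rep : (int -> 'I_n.+1) -> int -> 'I_n.+1.
Hypotheses (repP : forall f, cotail f (rep f))
           (rep_eq : forall f g, cotail f g -> rep f = rep g).

(** The right-hand side of the final equivalence depends on the family only
    through its union, so two families with the same union enumerate the same
    sequences once [L] is large enough for both. *)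
Lemma disjoint_rays_enum (I : finType) (R : I -> set (set (walk D))) :
  disjoint_rays R ->
  exists N : nat, forall L : nat, (N <= L)%N ->
  exists (d : I -> nat)
         (F : {i : I & {ffun 'I_(d i) -> 'I_n.+1}} -> int -> 'I_n.+1),
    injective F /\
    forall h, (exists x, F x = h) <->
      [/\ normal rep h, beam_of R (shift_class h)
        & forall i : int, L%:Z <= i -> h i = ord0].
Proof.
move=> [rayR trivR].
have [g gP] := choice (fun i => cone_normal repP rep_eq (rayR i)).
have [m {}gP] := choice gP.
exists (\max_i `|m i|)%N => L NL.
have mL i : m i <= L%:Z.
  by have := @leq_bigmax _ (fun i => `|m i|%N) i; lia.
pose d i := `|L%:Z - m i|%N.
have md i : m i + (d i)%:Z = L%:Z by rewrite /d; have := mL i; lia.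
pose F (x : {i : I & {ffun 'I_(d i) -> 'I_n.+1}}) :=
  graft (g (tag x)) (m (tag x)) (tagged x).
have FP x : [/\ normal rep (F x), R (tag x) (shift_class (F x)) &
    forall i : int, L%:Z <= i -> F x i = ord0].
  have [ag h0] : agree (m (tag x)) (F x) (g (tag x)) /\
      forall i, m (tag x) + (d (tag x))%:Z <= i -> F x i = ord0.
    by apply/graftP; exists (tagged x).
  rewrite md in h0; have [ng Rg] := gP (tag x).
  have nF : normal rep (F x) by apply: normal_agree (agree_sym ag) ng.
  by split=> //; apply/Rg.
exists d, F; split=> [x y e|h].
  have [_ Rx _] := FP x; have [_ Ry _] := FP y.
  (* Equal sequences from different rays would contradict disjointness. *)
  have exy : tag x = tag y.
    by apply: trivR => //; exists (shift_class (F x)); split; rewrite // e.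
  case: x y exy e {Rx Ry} => [i u] [j v] /= ij; case: _ / ij v => v e.
  by congr (Tagged _ _); apply: graft_inj e.
split=> [[x <-]|[nh [i _ Rh] h0]].
  by have [? ? ?] := FP x; split=> //; exists (tag x).
have [u uh] : exists u, @graft (g i) (m i) (d i) u = h.
  by apply/graftP; rewrite md; split=> //; apply/(gP i).2.
by exists (Tagged (fun i => {ffun 'I_(d i) -> 'I_n.+1}) u).
Qed.

End Family.

Lemma card_blocks (I : finType) (d : I -> nat) :
  #|{: {i : I & {ffun 'I_(d i) -> 'I_n.+1}}}| = (\sum_i n.+1 ^ d i)%N.
Proof.
rewrite card_tagged sumnE big_map big_enum.
by apply: eq_bigr => i _; rewrite card_ffun !card_ord.
Qed.

Lemma disjoint_rays_count (I J : finType)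
    (R : I -> set (set (walk D))) (S : J -> set (set (walk D))) :
  disjoint_rays R -> disjoint_rays S -> beam_of R = beam_of S ->
  exists (d : I -> nat) (e : J -> nat),
    (\sum_i n.+1 ^ d i = \sum_j n.+1 ^ e j)%N.
Proof.
move=> dR dS RS; have [rep [repP rep_eq]] := cotail_section 'I_n.+1.
have [N enumR] := disjoint_rays_enum repP rep_eq dR.
have [N' enumS] := disjoint_rays_enum repP rep_eq dS.
have [d [F [injF FP]]] := enumR (maxn N N') (leq_maxl _ _).
have [e [G [injG GP]]] := enumS (maxn N N') (leq_maxr _ _).
exists d, e; rewrite -!card_blocks; apply/eqP; rewrite eqn_leq.
apply/andP; split.
  by apply: leq_card_codom injF _ => x; apply/GP; rewrite -RS; apply/FP; exists x.
by apply: leq_card_codom injG _ => x; apply/FP; rewrite RS; apply/GP; exists x.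
Qed.

(** The class of [k] in the dimension monoid of the rose with [n.+1] leaves:
    zero is kept apart, and the positive integers modulo [n] are represented by
    [1], ..., [n]. *)
Definition beam_class (k : nat) : nat :=
  if k is k'.+1 then (k' %% n).+1 else 0%N.

(** Powers of [n.+1] are positive and congruent to [1] modulo [n]. *)
Lemma beam_class_sum (I : finType) (d : I -> nat) :
  beam_class (\sum_i n.+1 ^ d i)%N = beam_class #|I|.
Proof.
have modS : (\sum_i n.+1 ^ d i = #|I| %[mod n])%N.
  rewrite -modn_summ -sum1_card -[in RHS]modn_summ; congr (_ %% _)%N.
  by apply: eq_bigr => i _; rewrite -modnXm -addn1 modnDl modnXm exp1n.
have S0 : ((\sum_i n.+1 ^ d i)%N == 0%N) = (#|I| == 0%N).
  rewrite sum_nat_eq0 -sum1_card sum_nat_eq0.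
  by apply: eq_forallb => i; rewrite expn_eq0.
move: modS S0; case: #|I| => [|k]; case: (\sum_i _)%N => [|s] //= /eqP e _.
by congr S; apply/eqP; rewrite -(eqn_modDr 1) !addn1.
Qed.

Lemma disjoint_rays_class (I J : finType)
    (R : I -> set (set (walk D))) (S : J -> set (set (walk D))) :
  disjoint_rays R -> disjoint_rays S -> beam_of R = beam_of S ->
  beam_class #|I| = beam_class #|J|.
Proof.
move=> dR dS /(disjoint_rays_count dR dS)[d [e de]].
by rewrite -(beam_class_sum d) de beam_class_sum.
Qed.

End Counting.

(** * Splitting rays *)

Lemma disjoint_rays_comp (D : finDigraph) (I J : Type) (s : J -> I)
    (R : I -> set (set (walk D))) :
  injective s -> disjoint_rays R -> disjoint_rays (R \o s).
Proof.
move=> injs [rayR trivR]; split=> [j|j k _ _ jk]; first exact: rayR.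
by apply: injs; apply: trivR.
Qed.

Section Splitting.
Variable n : nat.
Local Notation D := (rose n).

Definition extend (f : int -> 'I_n) (m : int) (a : 'I_n) : int -> 'I_n :=
  fun i => if i == m then a else f i.

Lemma agree_extend f m a : agree m (extend f m a) f.
Proof. by move=> i im; rewrite /extend; case: eqP => // ?; lia. Qed.

Lemma cone_split f m : cone f m = \bigcup_a cone (extend f m a) (m + 1).
Proof.
apply/seteqP; split=> [_ [h hf <-]|_ [a _ [h hf <-]]].
  exists (h m) => //; exists h => // i im; rewrite /extend.
  by case: eqP => [->//|ni]; apply: hf; lia.
exists h => //; apply: agree_trans (agreeW _ hf) (@agree_extend _ _ _); lia.
Qed.

Lemma trivIset_cone_extend f m :
  aperiodic f -> trivIset [set: 'I_n] (fun a => cone (extend f m a) (m + 1)).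
Proof.
move=> af a b _ _ [x [[g ga <-] [h hb]]] hg.
have gf := agree_trans (agreeW (k := m) _ ga) (@agree_extend f m a).
have hf := agree_trans (agreeW (k := m) _ hb) (@agree_extend f m b).
have gh : h = g.
  apply: shift_class_inj hg.
    by apply: agree_trans (hf _) (agree_sym (gf _)); lia.
  by apply: aperiodic_agree (agree_sym (hf _)) af; lia.
have := hb m; rewrite gh ga /extend ?eqxx; last lia.
by apply; lia.
Qed.

(** Replacing one ray of a disjoint family by its [n] one-step extensions keeps
    the beam.  The distinguished ray is the one indexed by [None]. *)
Lemma disjoint_rays_split (I : Type) (R : option I -> set (set (walk D))) :
  disjoint_rays R -> exists S : 'I_n + I -> set (set (walk D)),
    disjoint_rays S /\ beam_of S = beam_of R.
Proof.
move=> [rayR trivR].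
have /is_unindexed_rayP[f [m [af RN]]] := rayR None.
pose C a : set (set (walk D)) := cone (extend f m a) (m + 1).
have CN : R None = \bigcup_a C a by rewrite RN cone_split.
have trivC : trivIset [set: 'I_n] C by apply: trivIset_cone_extend.
(* Each new ray lies in the old ray [R (o x)], so that disjointness of rays with
   different [o] is inherited. *)
pose o (x : 'I_n + I) := if x is inr i then Some i else None.
pose S (x : 'I_n + I) := if x is inl a then C a else R (o x).
have SR x : S x `<=` R (o x).
  by case: x => [a|i] /=; rewrite ?CN; [apply: bigcup_sup | apply: subset_refl].
exists S; split; first split.
- case=> [a|i] /=; last exact: rayR.
  apply/is_unindexed_rayP; exists (extend f m a), (m + 1); split=> //.
  exact: aperiodic_agree (agree_sym (@agree_extend f m a)) af.
- move=> x y _ _ xy.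
  have : o x = o y.
    by apply: trivR => //; case: xy => z [/SR ? /SR ?]; exists z.
  case: x y xy => [a|i] [b|j] //= xy.
    by rewrite (trivC a b).
  by move=> [->].
apply/seteqP; split=> [z [x _ /SR Rz]|z [[i|] _]]; first by exists (o x).
  by exists (inr i).
by rewrite CN => -[a _ Ca]; exists (inl a).
Qed.

End Splitting.

(** * The dimension monoid of a rose *)

Section RoseMonoid.
Variable n : nat.
Local Notation D := (rose n.+1).

Lemma rose_core_vertex : core_vertex (D := D) tt.
Proof. by apply/asboolP; exists (of_label (fun=> ord0)), 0. Qed.

Definition core_tt : fvertex (core D) := exist _ tt rose_core_vertex.

Lemma core_vertexE (x : fvertex (core D)) : x = core_tt.
Proof. by apply: val_inj; case: (val x). Qed.

Definition uniform (k : nat) : multiset D := [ffun=> k].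

Lemma uniformE (M : multiset D) : M = uniform (M core_tt).
Proof. by apply/ffunP => x; rewrite ffunE [x]core_vertexE. Qed.

(** With a single vertex, a vertex count is the number of rays. *)
Lemma vertex_countP (M : multiset D) (B : set (set (walk D))) :
  vertex_count M B <->
  exists R : 'I_(M core_tt) -> set (set (walk D)),
    disjoint_rays R /\ B = beam_of R.
Proof.
split=> [[k [R [v [rayR trivR -> Mv]]]]|[R [[rayR trivR] ->]]].
  have -> : M core_tt = k.
    rewrite Mv -[RHS]card_ord; apply: eq_card => i.
    by rewrite !inE [v i]core_vertexE eqxx.
  by exists R; split=> //; split=> // i; have [] := rayR i.
exists (M core_tt), R, (fun=> core_tt); split=> // [i|x].
  split=> //; have [w [m [aw Rw]]] := rayR i.
  by exists w, m; split=> //; case: (homV w _).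
rewrite -[LHS]card_ord [x]core_vertexE; apply: eq_card => i.
by rewrite !inE eqxx.
Qed.

Lemma common_beamP (M M' : multiset D) : common_beam M M' <->
  exists (R : 'I_(M core_tt) -> set (set (walk D)))
         (S : 'I_(M' core_tt) -> set (set (walk D))),
    [/\ disjoint_rays R, disjoint_rays S & beam_of R = beam_of S].
Proof.
split=> [[B [_ /vertex_countP[R [dR RB]] /vertex_countP[S [dS SB]]]]|].
  by exists R, S; split; rewrite // -RB.
move=> [R [S [dR dS RS]]]; exists (beam_of R); split.
- by exists (M core_tt), R; split=> //; case: dR.
- by apply/vertex_countP; exists R.
by apply/vertex_countP; exists S.
Qed.

Lemma udaf_rel_class (M M' : multiset D) :
  udaf_rel M M' -> beam_class n (M core_tt) = beam_class n (M' core_tt).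
Proof.
elim=> [{}M {}M' /common_beamP[R [S [dR dS RS]]]|//|//|{}M N {}M' _ -> _ -> //].
by have := disjoint_rays_class dR dS RS; rewrite !card_ord.
Qed.

Lemma common_beam_uniform (I J : finType)
    (R : I -> set (set (walk D))) (S : J -> set (set (walk D))) :
  disjoint_rays R -> disjoint_rays S -> beam_of R = beam_of S ->
  common_beam (uniform #|I|) (uniform #|J|).
Proof.
have enum (K : finType) (Q : K -> set (set (walk D))) : disjoint_rays Q ->
    exists Q' : 'I_(uniform #|K| core_tt) -> set (set (walk D)),
      disjoint_rays Q' /\ beam_of Q' = beam_of Q.
  rewrite ffunE => dQ; exists (Q \o enum_val); split.
    by apply: disjoint_rays_comp dQ; apply: enum_val_inj.
  apply/seteqP; split=> z [i _ zi]; first by exists (enum_val i).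
  by exists (enum_rank i) => //=; rewrite enum_rankK.
move=> /enum[R' [dR' <-]] /enum[S' [dS' <-]] RS.
by apply/common_beamP; exists R', S'.
Qed.

End RoseMonoid.

Section RoseMonoidCard.
Variable n : nat.
Local Notation D := (rose n.+2).

(** Starting from one ray, each splitting yields at least one more, because there
    are two leaves or more; superfluous rays are discarded by restricting the
    family along an injection. *)
Lemma disjoint_rays_exist (k : nat) :
  exists R : 'I_k -> set (set (walk D)), disjoint_rays R.
Proof.
suff [R dR] : exists R : option 'I_k -> set (set (walk D)), disjoint_rays R.
  by exists (R \o Some); apply: disjoint_rays_comp dR => i j [].
elim: k => [|k [R dR]].
  exists (fun=> cone (@pow2_marks n) 0); split=> [_|[[]|] // [[]|] //].
  apply/is_unindexed_rayP; exists (@pow2_marks n), 0; split=> //.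
  exact: pow2_marks_aperiodic.
have [S [dS _]] := disjoint_rays_split dR.
(* Two of the new rays, the extensions by [ord0] and [ord_max], join the [k]
   old ones left untouched. *)
pose s (x : option 'I_k.+1) : 'I_n.+2 + 'I_k :=
  if x is Some i then (if unlift ord0 i is Some j then inr j else inl ord0)
  else inl ord_max.
exists (S \o s); apply: disjoint_rays_comp dS.
case=> [i|] [j|] //=; do ?case: unliftP => [?|] -> //=; by case=> // ->.
Qed.

(** Splitting one of [k.+1] disjoint rays trades it for [n.+2] rays. *)
Lemma udaf_rel_split (k : nat) :
  udaf_rel (uniform n.+1 k.+1) (uniform n.+1 (k.+1 + n.+1)).
Proof.
have [R dR] := disjoint_rays_exist k.+1.
have dR' : disjoint_rays (R \o oapp (lift ord0) ord0).
  apply: disjoint_rays_comp dR => -[i|] [j|] //= e.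
  by rewrite (lift_inj e).
have [S [dS RS]] := disjoint_rays_split dR'.
apply: rst_step.
have := common_beam_uniform dR' dS (esym RS).
rewrite card_option card_sum !card_ord; congr common_beam; congr uniform; lia.
Qed.

Lemma udaf_rel_beam_class (k : nat) :
  udaf_rel (uniform n.+1 (beam_class n.+1 k)) (uniform n.+1 k).
Proof.
case: k => [|k]; first exact: rst_refl.
rewrite /= {2}(divn_eq k n.+1).
elim: (k %/ n.+1)%N => [|q IHq]; first exact: rst_refl.
apply: rst_trans IHq _.
have := udaf_rel_split (q * n.+1 + k %% n.+1).
by congr udaf_rel; congr uniform; rewrite mulSn; lia.
Qed.

Lemma udaf_relP (M M' : multiset D) :
  udaf_rel M M' <->
  beam_class n.+1 (M (core_tt n.+1)) = beam_class n.+1 (M' (core_tt n.+1)).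
Proof.
split=> [|e]; first exact: udaf_rel_class.
rewrite (uniformE M) (uniformE M'); apply: rst_trans (udaf_rel_beam_class _).
by rewrite -e; apply/rst_sym/udaf_rel_beam_class.
Qed.

Lemma beam_class_lt k : (beam_class n.+1 k < n.+2)%N.
Proof. by case: k => //= k; rewrite ltnS ltn_pmod. Qed.

Lemma beam_class_id k : (k < n.+2)%N -> beam_class n.+1 k = k.
Proof. by case: k => //= k; rewrite ltnS => kn; rewrite modn_small. Qed.

(** The values of [beam_class] are the numbers below [n.+2], so the next two maps
    are mutually inverse; [dim_of_ordK] and [ord_of_dim_inj] give this. *)
Definition dim_of_ord (j : 'I_n.+2) : dim_monoid D :=
  \pi_(dim_monoid D)%qT (uniform n.+1 j).

Definition ord_of_dim (x : dim_monoid D) : 'I_n.+2 :=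
  Ordinal (beam_class_lt ((repr x : multiset D) (core_tt n.+1))).

Lemma dim_of_ordK : cancel dim_of_ord ord_of_dim.
Proof.
move=> j; apply: val_inj => /=.
have : udaf_rel (repr (dim_of_ord j)) (uniform n.+1 j).
  have /eqquotP/asboolP // :
      (repr (dim_of_ord j) = uniform n.+1 j %[mod dim_monoid D])%qT.
  by rewrite reprK.
by move=> /udaf_relP ->; rewrite ffunE beam_class_id.
Qed.

Lemma ord_of_dim_inj : injective ord_of_dim.
Proof.
move=> x y /(congr1 val) /= e; rewrite -[x]reprK -[y]reprK.
by apply/eqquotP/asboolP/udaf_relP.
Qed.

(** Constant labellings by two different leaves already give two walks. *)
Lemma rose_is_udaf : is_udaf D.
Proof.
have two (G : digraph) (g0 : vertex G) (e0 : edge G) (v : fvertex D) :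
    ~ (exists! h : dhom G D, homV h g0 = v).
  case: v => -[h [_ uniq_h]].
  pose c (a : 'I_n.+2) : dhom G D := labelled (fun=> a).
  have := uniq_h (c ord0) erefl; rewrite (uniq_h (c ord_max) erefl).
  by move=> /(congr1 (fun u : dhom G D => val (homE u e0 : 'I_n.+2))).
move=> v; split; apply: two; first by exists 0.
by exists (-1).
Qed.

End RoseMonoidCard.

Lemma leq_rose_dim (n m : nat)
    (f : dim_monoid (rose n.+2) -> dim_monoid (rose m.+2)) :
  injective f -> (n <= m)%N.
Proof.
move=> injf; have := @leq_card _ _ (@ord_of_dim m \o f \o @dim_of_ord n).
rewrite !card_ord; apply.
apply: inj_comp (inj_comp _ _) (can_inj (@dim_of_ordK n)) => //.
exact: ord_of_dim_inj.
Qed.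

Local Close Scope classical_set_scope.
Local Close Scope ring_scope.

Theorem corollary6p10 (n m : nat) (hn : 2 <= n) (hm : 2 <= m) :
  weak_udaf_equivalent (rose n) (rose m) <-> n = m.
Proof.
case: n m hn hm => [|[|n]] // [|[|m]] // _ _.
split=> [[_ _ [f [[g fK gK] _ _]]]|[->]].
  congr _.+2; apply/eqP; rewrite eqn_leq.
  by rewrite (leq_rose_dim (can_inj fK)) (leq_rose_dim (can_inj gK)).
split; [exact: rose_is_udaf | exact: rose_is_udaf |].
by exists id; split=> //; exists id.
Qed.
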